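(* Let $(X,d)$ be a compact metric space, let $\phi$ be a continuous flow on $X$ without fixed points, let $f=\phi_1$, and let $L\in\mathbb{N}$. For every $\varepsilon>0$ there is $\delta_0>0$ such that for every $x\in X$, $\delta\in(0,\delta_0)$ and $t>L$ there exists $\{x_1,\ldots,x_\ell\}\subset\Gamma^+_\delta(x,t)$ such that $$\Gamma^+_\delta(x,t)\subseteq\bigcup_{i=1}^{\ell}B^{nL}_f(x_i,\varepsilon),$$ where $n=\left\lfloor\frac{t}{L}\right\rfloor$ and $\ell\le 3^{n-1}$. Furthermore, for any compact set $K\subseteq X$ containing $x$, the set $K\cap\Gamma^+_\delta(x,t)$ can be covered by at most $3^{n-1}$ balls $B^{nL}_f(x_i,\varepsilon)$ whose centers belong to $K$.
   Context: A continuous flow on $X$ is a continuous map $\phi:\mathbb{R}\times X\to X$ with $\phi(0,x)=x$ and $\phi(t+s,x)=\phi(s,\phi(t,x))$; write $\phi_t=\phi(t,\cdot)$. A point $x$ is fixed if $\phi_t(x)=x$ for all $t$. Let $Rep$ be the set of increasing homeomorphisms $h:\mathbb{R}\to\mathbb{R}$ with $h(0)=0$. For $x\in X$, $t\ge0$ and $\delta>0$, $$\Gamma^+_\delta(x,t)=\{y\in X:\ \exists h\in Rep\text{ s.t. }d(\phi_s(x),\phi_{h(s)}(y))\le\delta\ \ \forall s\in[0,t]\}.$$ For a continuous map $f:X\to X$, $m\in\mathbb{N}$ and $\varepsilon>0$, $$B^m_f(x,\varepsilon)=\{y\in X:\ d(f^i(x),f^i(y))\le\varepsilon,\ i=0,\ldots,m\}.$$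 *)

(* Defs.v *)
From mathcomp Require Import all_boot all_order all_algebra.
From mathcomp Require Import all_classical all_reals all_analysis.
Set Implicit Arguments.
Unset Strict Implicit.
Unset Printing Implicit Defensive.
Import Order.TTheory GRing.Theory Num.Theory.
Import numFieldNormedType.Exports.
Local Open Scope classical_set_scope.
Local Open Scope ring_scope.

Definition continuous_flow (R : realType) (X : metricType R)
    (phi : R -> X -> X) : Prop :=
  [/\ continuous (fun p : R * X => phi p.1 p.2),
      forall x, phi 0 x = x &
      forall t s x, phi (t + s) x = phi s (phi t x)].

Definition fixed_point (R : realType) (X : metricType R)
    (phi : R -> X -> X) (x : X) : Prop :=
  forall t, phi t x = x.

Definition homeomorphism (S T : topologicalType) (h : S -> T) : Prop :=
  continuous h /\
  exists g : T -> S, [/\ cancel h g, cancel g h & continuous g].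

Definition Rep (R : realType) : set (R -> R) :=
  [set h : R -> R | [/\ {homo h : s t / s < t}, homeomorphism h & h 0 = 0]].

Definition Gamma_plus (R : realType) (X : metricType R)
    (phi : R -> X -> X) (delta : R) (x : X) (t : R) : set X :=
  [set y | exists2 h : R -> R, Rep h &
     forall s, 0 <= s <= t -> mdist (phi s x) (phi (h s) y) <= delta].

(* [m] is the last iterate: the ball constrains the m + 1 times 0, 1, ..., m. *)
Definition Bowen_ball (R : realType) (X : metricType R)
    (f : X -> X) (m : nat) (x : X) (eps : R) : set X :=
  [set y | forall i : nat, (i <= m)%N ->
     mdist (iter i f x) (iter i f y) <= eps].

(* Main.v *)
Require Import Defs.
From mathcomp Require Import all_boot all_order all_algebra.
From mathcomp Require Import all_classical all_reals all_analysis.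
From mathcomp Require Import zify ring lra.
Set Implicit Arguments.
Unset Strict Implicit.
Unset Printing Implicit Defensive.
Import Order.TTheory GRing.Theory Num.Theory.
Import numFieldNormedType.Exports.
Local Open Scope classical_set_scope.
Local Open Scope ring_scope.

(** A point y of Gamma_plus phi delta x t follows the orbit of x after a
reparametrization h, so everything depends on the drift h(s) - s.

Since no point is fixed and X is compact, the flow has no periods in some
interval ]0, T0[ (no_small_period).  Fix eta < T0 so small that times less than
5 eta apart give points of an orbit less than eps / 4 apart.  Then
d(z, phi_eta z) is bounded below, and hence, on time windows of any prescribed
length T, the drift varies by less than eta as soon as delta is small: if it
reached eta, then by the intermediate value theorem phi_{h(s)}(y) and
its displacement by eta or - eta would both be close to phi_s(x) at some time s
(shadowing_drift_small).

The window T = (q + 1) L is chosen much longer than L, so that [0, nL] consists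
of only M = n / (q + 1) full windows and a remainder.  Two things have to be
recorded about y.
- The drift at the beginning of each window, up to an error eta.  It starts at
  0, and its integer part in units of eta changes by -1, 0 or 1 from one window
  to the next: 3 ^ M possibilities.
- The end of the orbit.  A negative drift may accumulate, and then phi_i(y) is
  compared with nothing on the orbit of x for i close to nL.  But the total
  drift is at least - (M + 1) eta >= - M - eta, so this concerns at most the M
  last integer times.  For these one records directly the cell containing
  phi_i(y) in a fixed partition of X into r + 1 cells of diameter at most eps:
  (r + 1) ^ M possibilities.
Points with the same record are eps-close at all integer times up to nL
(same_symbols_close handles the times controlled by the drift), so one point
for each record that occurs gives the centers (pigeonhole_cover).  These can be
taken in any subset of Gamma_plus that is to be covered, which gives both
parts of the theorem.  There are (3 (r + 1)) ^ M records, and q was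
chosen with 3 (r + 1) <= 3 ^ q, which gives at most 3 ^ (n - 1) of them
(code_count).  In particular, while n <= q there is no full window, and a single
ball is enough. *)

(** * Compactness *)

(** A local condition on a scale d that holds at all small scales near each point
holds at all small scales uniformly.  The uniform constants of the flow below
come from this form of compactness. *)
Lemma compact_uniform_radius (R : realType) (U : topologicalType) (K : set U)
    (P : R -> U -> Prop) :
  compact K ->
  (forall u, K u ->
     exists2 r : R, 0 < r & \forall v \near u, forall d, 0 < d < r -> P d v) ->
  exists2 r : R, 0 < r & forall d u, 0 < d < r -> K u -> P d u.
Proof.
move=> /compact_near_coveringP cK locP.
have /cK : forall u, K u ->
    \forall v \near u & d \near (0 : R)^'+, P d v.
  move=> u /locP[r r0 Pr]; exists ([set v | forall d, 0 < d < r -> P d v],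
    [set d | 0 < d < r]); last by move=> [v d] [/= + dr]; exact.
  split=> //=; near=> d; apply/andP; split; near: d.
    exact: nbhs_right_gt.
  exact: nbhs_right_lt.
move=> [r /= r0 rP]; exists r => // d u /andP[d0 dr] Ku.
by apply: rP => //=; rewrite sub0r normrN gtr0_norm.
Unshelve. all: by end_near. Qed.

(** The cells of a finite partition, presented as the fibres of a map to an
ordinal so that they can serve as symbols of a code.  The finite subcover is
obtained from near coverings along the filter of large finite sequences, a form of
compactness that asks for no base point, so that X may be empty. *)
Lemma compact_small_classes (R : realType) (X : metricType R) (e : R) :
  compact [set: X] -> 0 < e ->
  exists (r : nat) (c : X -> 'I_r.+1),
    forall x y, c x = c y -> mdist x y < e.
Proof.
move=> cX e0; have e20 : 0 < e / 2 by rewrite divr_gt0.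
pose sup (s : seq X) := [set s' : seq X | {subset s <= s'}].
have supF : Filter (filter_from setT sup).
  apply: filter_from_filter => [|s s' _ _]; first by exists [::].
  exists (s ++ s') => // u su.
  by split=> x xs; apply: su; rewrite mem_cat xs ?orbT.
have [|D _ covD] := iffLR (compact_near_coveringP _) cX _ (filter_from setT sup)
    (fun s x => exists z, z \in s /\ ball z (e / 2) x) supF.
  move=> x _; exists (ball x (e / 2), sup [:: x]).
    by split; [exact: nbhsx_ballx|exists [:: x]].
  by move=> [y s] [/= xy sx]; exists x; split=> //; apply: sx; rewrite inE.
have /choice[g gP] : forall x, exists z, z \in D /\ ball z (e / 2) x.
  by move=> x; exact: (covD D).
exists (size D), (fun x => inord (index (g x) D)) => x y /(congr1 val).
have [[Dx xball] [Dy yball]] := (gP x, gP y).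
rewrite /= !inordK ?ltnS ?index_size // => /(congr1 (nth (g x) D)).
rewrite !nth_index // => gxy; rewrite -gxy in yball.
by have := ball_triangle (ball_sym xball) yball; rewrite -splitr ballEmdist.
Qed.

(** * Flows without fixed points *)

Section flow.
Variables (R : realType) (X : metricType R) (phi : R -> X -> X).
Hypothesis phi_flow : continuous_flow phi.

Let flow0 x : phi 0 x = x.
Proof. by case: phi_flow. Qed.

Let flowD t s x : phi (t + s) x = phi s (phi t x).
Proof. by case: phi_flow. Qed.

Lemma flow_continuous_at (s0 : R) (x0 : X) (e : R) : 0 < e ->
  exists2 r : R, 0 < r & forall s x, `|s - s0| < r -> mdist x0 x < r ->
    mdist (phi s0 x0) (phi s x) < e.
Proof.
move=> e0; have [cphi _ _] := phi_flow.
have /nbhs_ballP[r /= r0 rP] : nbhs (s0, x0)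
    [set p | ball (phi s0 x0) e (phi p.1 p.2)].
  by apply: (cphi (s0, x0)); exact: nbhsx_ballx.
exists r => // s x ss0 xx0; have := rP (s, x); rewrite /= ballEmdist; apply.
by split; rewrite /= ?ballEmdist // /ball /= distrC.
Qed.

Lemma flow_small_time (e : R) : compact [set: X] -> 0 < e ->
  exists2 r : R, 0 < r & forall s x, `|s| < r -> mdist x (phi s x) < e.
Proof.
move=> cX e0; have e20 : 0 < e / 2 by rewrite divr_gt0.
have [|r r0 rP] := compact_uniform_radius
    (P := fun d x => forall s, `|s| < d -> mdist x (phi s x) < e) cX.
  move=> x0 _; have [r r0 rP] := flow_continuous_at 0 x0 e20; exists r => //.
  have m0 : 0 < Num.min r (e / 2) by rewrite lt_min r0.
  apply: filterS (nbhsx_ballx x0 _ m0) => x.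
  rewrite ballEmdist /= lt_min => /andP[xr xe] d /andP[_ dr] s sd.
  have := rP s x; rewrite subr0 flow0 => /(_ (lt_trans sd dr) xr).
  by have := metric_triangle x x0 (phi s x); rewrite (metric_sym x x0); lra.
exists (r / 2) => [|s x sr]; first by rewrite divr_gt0.
by apply: (rP (r / 2)) => //; apply/andP; split; lra.
Qed.

Lemma flow_equicontinuous (T e : R) : compact [set: X] -> 0 < e ->
  exists2 r : R, 0 < r & forall s x y, 0 <= s <= T -> mdist x y < r ->
    mdist (phi s x) (phi s y) < e.
Proof.
move=> cX e0; have e20 : 0 < e / 2 by rewrite divr_gt0.
have cK := compact_setX (@segment_compact _ (0 : R) T) cX.
have [|r r0 rP] := compact_uniform_radius (P := fun (d : R) p =>
    forall y, mdist p.2 y < d -> mdist (phi p.1 p.2) (phi p.1 y) < e) cK.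
  move=> [s0 x0] _; have [r r0 rP] := flow_continuous_at s0 x0 e20.
  have r20 : 0 < r / 2 by rewrite divr_gt0.
  exists (r / 2) => //; apply: filterS (nbhsx_ballx (s0, x0) _ r20) => -[s x].
  move=> [/= + +] d /andP[_ dr] y xy; rewrite ballEmdist /ball /= distrC => ss xx.
  have sr : `|s - s0| < r by lra.
  have xr : mdist x0 x < r by lra.
  have yr : mdist x0 y < r by have := metric_triangle x0 x y; lra.
  have := metric_triangle (phi s x) (phi s0 x0) (phi s y).
  by rewrite (metric_sym (phi s x) (phi s0 x0)); have := rP s x sr xr; have := rP s y sr yr; lra.
exists (r / 2) => [|s x y sT xy]; first by rewrite divr_gt0.
apply: (rP (r / 2) (s, x)) => //=; by apply/andP; split; lra.
Qed.

Let flowMn (tau : R) (x : X) (k : nat) : phi tau x = x -> phi (tau *+ k) x = x.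
Proof.
by move=> px; elim: k => [|k IH]; rewrite ?mulr0n ?flow0 // mulrSr flowD IH.
Qed.

(** If phi_d(x) = x, then every point phi_t(x) with t >= 0 equals phi_s(x) for some
s in [0, d[, so a tiny period d keeps the whole orbit close to x; near a
point x0 that phi_t moves by a definite distance this is impossible. *)
Lemma no_small_period : compact [set: X] ->
  (forall x : X, ~ fixed_point phi x) ->
  exists2 T0 : R, 0 < T0 & forall tau x, 0 < tau < T0 -> phi tau x <> x.
Proof.
move=> cX nofix.
have [|r r0 rP] := compact_uniform_radius
    (P := fun d x => phi d x <> x) cX; last by exists r => // *; exact: rP.
move=> x0 _.
have [t t0 ptx] : exists2 t, 0 <= t & phi t x0 <> x0.
  (* phi_{-t} moves x0 whenever phi_t does, so the sign of t is free. *)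
  have /existsNP[t pt] := nofix x0.
  have [t0|t0] := leP 0 t; first by exists t.
  exists (- t) => [|pmt]; first by lra.
  by apply: pt; rewrite -{1}pmt -flowD addNr flow0.
pose e := mdist x0 (phi t x0) / 2.
have e0 : 0 < e.
  by rewrite divr_gt0 // mdist_gt0; apply/eqP => /esym.
have e20 : 0 < e / 2 by rewrite divr_gt0.
have [r r0 rP] := flow_small_time cX e0.
have [u u0 uP] := flow_continuous_at t x0 e20.
exists r => //; have m0 : 0 < Num.min u (e / 2) by rewrite lt_min u0.
apply: filterS (nbhsx_ballx x0 _ m0) => x.
rewrite ballEmdist /= lt_min => /andP[xu xe] d /andP[d0 dr] pdx.
pose k := Num.truncn (t / d).
have /andP[kt tk] : k%:R <= t / d < k.+1%:R.
  by apply: truncn_itv; rewrite divr_ge0 // ltW.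
rewrite ler_pdivlMr // in kt; rewrite ltr_pdivrMr // -natr1 mulrDl mul1r in tk.
have : phi t x = phi (t - d *+ k) x.
  by rewrite -{1}(subrKC (d *+ k) t) flowD flowMn.
move=> ptk; have := rP (t - d *+ k) x.
rewrite -ptk -mulr_natl ger0_norm ?subr_ge0 // => /(_ ltac:(lra)).
have := uP t x; rewrite subrr normr0 => /(_ u0 xu).
have := metric_triangle x0 x (phi t x0).
have := metric_triangle x (phi t x) (phi t x0).
rewrite (metric_sym (phi t x) (phi t x0)) /e in xe e0 e20 *; lra.
Qed.

Lemma flow_displacement_bounded_below (tau : R) : compact [set: X] ->
  (forall x, phi tau x <> x) ->
  exists2 g : R, 0 < g & forall x, g < mdist x (phi tau x).
Proof.
move=> cX noper.
have [|r r0 rP] := compact_uniform_radius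
    (P := fun d x => d < mdist x (phi tau x)) cX; last first.
  by exists (r / 2) => [|x]; [rewrite divr_gt0|apply: rP => //; apply/andP; split; lra].
move=> x0 _; pose e := mdist x0 (phi tau x0) / 3.
have e0 : 0 < e.
  by rewrite divr_gt0 // mdist_gt0; apply/eqP => /esym /noper.
have [u u0 uP] := flow_continuous_at tau x0 e0.
exists e => //; have m0 : 0 < Num.min u e by rewrite lt_min u0.
apply: filterS (nbhsx_ballx x0 _ m0) => x.
rewrite ballEmdist /= lt_min => /andP[xu xe] d /andP[d0 dr].
have := uP tau x; rewrite subrr normr0 => /(_ u0 xu).
have := metric_triangle x0 x (phi tau x0).
have := metric_triangle x (phi tau x) (phi tau x0).
rewrite (metric_sym (phi tau x) (phi tau x0)) /e in xe dr *; lra.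
Qed.

(** With z = phi_{c - a}(phi_{h(a)}(y)), the point phi_{h(c)}(y) is z displaced by
the drift accumulated on [a, c].  Both points are close to phi_c(x): the first
because orbits starting close stay close for time T, the second by shadowing.
If the accumulated drift left ]-eta, eta[, it would equal eta or - eta at
some c, and z would be too close to its displacement.  The bound delta depends on
the length T of the window only, not on its position in [0, t]. *)
Lemma shadowing_drift_small (T eta : R) : compact [set: X] -> 0 < eta ->
  (forall x, phi eta x <> x) ->
  exists2 delta : R, 0 < delta & forall x y (h : R -> R) t, continuous h ->
    (forall s, 0 <= s <= t -> mdist (phi s x) (phi (h s) y) <= delta) ->
    forall a b, 0 <= a -> a <= b -> b <= t -> b - a <= T ->
      `|(h b - b) - (h a - a)| < eta.
Proof.
move=> cX eta0 noper.
have [g g0 gP] := flow_displacement_bounded_below cX noper.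
have g20 : 0 < g / 2 by rewrite divr_gt0.
have [r r0 rP] := flow_equicontinuous T cX g20.
exists (Num.min (r / 2) (g / 2)) => [|x y h t hc shad a b a0 ab bt baT].
  by rewrite lt_min g20 divr_gt0.
rewrite ltNge; apply/negP => far.
pose D s := `|(h s - s) - (h a - a)|.
have Dc : {within `[a, b], continuous D}.
  apply: continuous_subspaceT => s.
  apply: cvg_norm; apply: cvgB; last exact: cvg_cst.
  by apply: cvgB; [exact: hc|exact: cvg_id].
have Da : D a = 0 by rewrite /D subrr normr0.
have [|c] := IVT ab Dc (v := eta).
  by rewrite Da ge_min (ltW eta0) le_max /= far orbT.
rewrite in_itv /= => /andP[ac cb] Dceta.
pose z := phi (c - a) (phi (h a) y).
have az : mdist (phi c x) z < g / 2.
  have -> : phi c x = phi (c - a) (phi a x) by rewrite -flowD subrKC.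
  apply: rP; first by apply/andP; split; lra.
  have := shad a; rewrite le_min => /(_ ltac:(apply/andP; split; lra)).
  by move=> /andP[]; lra.
have zh : phi (h c) y = phi ((h c - c) - (h a - a)) z.
  by rewrite -!flowD; congr (phi _ y); ring.
have hz : mdist z (phi (h c) y) < g.
  have := shad c; rewrite le_min => /(_ ltac:(apply/andP; split; lra)).
  have := metric_triangle z (phi c x) (phi (h c) y).
  by rewrite (metric_sym z (phi c x)) => + /andP[]; lra.
move: hz; rewrite zh; move: Dceta; rewrite /D; case: ger0P => _ sg.
  by rewrite sg; have := gP z; lra.
(* For the displacement - eta, exchange the roles of the two points. *)
set w := phi _ z => hz.
have wz : phi eta w = z by rewrite -flowD -sg addrN flow0.
by have := gP w; rewrite wz metric_sym; lra.
Qed.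

End flow.

(** * Coding the drift *)

(** Increments of the floor of a k / eta are shifted by 1 to fit in 'I_3 when they
belong to {-1, 0, 1}. *)
Definition drift_symbol (R : realType) (eta : R) (a : nat -> R) (k : nat)
    : 'I_3 :=
  inord (absz (Num.floor (a k.+1 / eta) - Num.floor (a k / eta) + 1)).

Lemma floor_increment (R : realType) (u v : R) : `|v - u| <= 1 ->
  -1 <= Num.floor v - Num.floor u <= 1.
Proof.
move=> uv; have := floor_itv u; have := floor_itv v.
have two : (2%:Z)%:~R = 2 :> R by [].
rewrite !intrD => /andP[v1 v2] /andP[u1 u2].
move: uv; rewrite ler_norml => /andP[uv1 uv2].
have : Num.floor v < Num.floor u + 2 by rewrite -(ltr_int R) intrD two; lra.
have : Num.floor u < Num.floor v + 2 by rewrite -(ltr_int R) intrD two; lra.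
by lia.
Qed.

(** The symbols give the increments of the integer parts of a k / eta; starting from
a common value, they determine the integer parts themselves, and therefore each
a k up to eta, with no accumulation of errors. *)
Lemma same_drift_symbols_close (R : realType) (eta : R) (M : nat)
    (a b : nat -> R) :
  0 < eta -> a 0 = b 0 ->
  (forall k, (k < M)%N -> `|a k.+1 - a k| <= eta) ->
  (forall k, (k < M)%N -> `|b k.+1 - b k| <= eta) ->
  (forall k, (k < M)%N -> drift_symbol eta a k = drift_symbol eta b k) ->
  forall k, (k <= M)%N -> `|a k - b k| < eta.
Proof.
move=> eta0 ab0 aM bM sab k kM.
have inc (u : nat -> R) j : `|u j.+1 - u j| <= eta ->
    -1 <= Num.floor (u j.+1 / eta) - Num.floor (u j / eta) <= 1.
  move=> uj; apply: floor_increment.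
  by rewrite -mulrBl normrM normfV (gtr0_norm eta0) ler_pdivrMr // mul1r.
have fl : Num.floor (a k / eta) = Num.floor (b k / eta).
  elim: k kM => [|k IH] kM; first by rewrite ab0.
  have := sab k kM; move/(congr1 val); rewrite /drift_symbol /=.
  have := inc a k (aM k kM); have := inc b k (bM k kM).
  move=> ib ia; rewrite !inordK; [|lia|lia].
  by have := IH (ltnW kM); lia.
have := floor_itv (a k / eta); have := floor_itv (b k / eta).
rewrite fl intrD => /andP[b1 b2] /andP[a1 a2].
have : `|a k / eta - b k / eta| < 1.
  by rewrite ltr_norml; apply/andP; split; lra.
by rewrite -mulrBl normrM normfV (gtr0_norm eta0) ltr_pdivrMr // mul1r.
Qed.

(** The allowance eta on the right end matters for the last window: the drift there
is not coded, and it may let h(b) miss v by up to eta. *)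
Lemma reparam_almost_reaches (R : realType) (h : R -> R) (b v eta : R) :
  continuous h -> h 0 = 0 -> 0 <= eta -> 0 <= b -> 0 <= v -> v <= h b + eta ->
  exists2 s, 0 <= s <= b & `|h s - v| <= eta.
Proof.
move=> hc h0 eta0 b0 v0 vb; have [hv|hv] := leP v (h b); last first.
  by exists b; [rewrite b0 lexx|rewrite ler_norml; apply/andP; split; lra].
have [||s] := IVT b0 (f := h) (v := v); first exact: continuous_subspaceT.
  by rewrite h0 ge_min v0 le_max hv orbT.
by rewrite in_itv /= => sb <-; exists s => //; rewrite subrr normr0.
Qed.

(** * Counting *)

(** Centers are chosen in S itself, one for each value of the code on S. *)
Lemma pigeonhole_cover (X : Type) (T : finType) (code : X -> T) (S : set X)
    (V : X -> set X) :
  (forall y z, S y -> S z -> code y = code z -> V y z) ->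
  exists (l : nat) (c : 'I_l -> X),
    [/\ (l <= #|T|)%N, forall i, S (c i) & S `<=` \bigcup_i V (c i)].
Proof.
move=> SV; pose A := [set v : T | `[< exists2 y, S y & code y = v >]]%SET.
have /choice[c cP] : forall i : 'I_#|A|, exists y, S y /\ code y = enum_val i.
  by move=> i; have := enum_valP i; rewrite inE => /asboolP[y]; exists y.
exists #|A|, c; split=> [||y Sy]; first exact: max_card.
  by move=> i; case: (cP i).
have Ay : code y \in A by rewrite inE; apply/asboolP; exists y.
exists (enum_rank_in Ay (code y)) => //.
have [Sc cc] := cP (enum_rank_in Ay (code y)).
by apply: SV => //; rewrite cc enum_rankK_in.
Qed.

(** One window of length q + 1 costs q powers of 3, and the one power saved on each
window pays for the exponent n - 1 as soon as there is a window. *)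
Lemma code_count (r q n : nat) : (3 * r.+1 <= 3 ^ q)%N -> (0 < n)%N ->
  ((3 * r.+1) ^ (n %/ q.+1) <= 3 ^ (n - 1))%N.
Proof.
move=> rq n0; apply: (@leq_trans ((3 ^ q) ^ (n %/ q.+1))).
  by case: (n %/ q.+1)%N => [//|m]; rewrite leq_exp2r.
rewrite -expnM leq_exp2l //; have := leq_trunc_div n q.+1.
case: (n %/ q.+1)%N => [|m]; lia.
Qed.

(** * Points with the same code *)

Definition drift (R : realType) (h : R -> R) (T : R) (k : nat) : R :=
  h (k%:R * T) - k%:R * T.

Lemma drift_ge (R : realType) (a : nat -> R) (eta : R) (M : nat) :
  a 0 = 0 -> (forall k, (k < M)%N -> `|a k.+1 - a k| <= eta) ->
  forall k, (k <= M)%N -> - (k%:R * eta) <= a k.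
Proof.
move=> a0 aM; elim=> [|k IH] kM; first by rewrite a0 mul0r oppr0.
have := aM k kM; have := IH (ltnW kM).
by rewrite ler_norml -natr1 mulrDl mul1r => ? /andP[]; lra.
Qed.

Lemma flow_iter (R : realType) (X : metricType R) (phi : R -> X -> X) :
  continuous_flow phi -> forall (i : nat) x, iter i (phi 1) x = phi i%:R x.
Proof.
move=> [_ flow0 flowD]; elim=> [|i IH] x; first by rewrite flow0.
by rewrite iterS IH -flowD natr1.
Qed.

(** Choose s with g(s) close to i.  The drifts of g and h agree up to eta at the
beginning of the window of s and move by less than eta within it, so that g(s) and
h(s) are both within 5 eta of i.  Then y and z at time i are
compared along phi_i(y), phi_{g(s)}(y), phi_s(x), phi_{h(s)}(z), phi_i(z), each
step costing at most eps / 4.  The integer times i > m - M are excluded because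
g(m) is only known to be at least m - M - eta. *)
Lemma same_symbols_close (R : realType) (X : metricType R) (phi : R -> X -> X)
    (T eta delta eps t : R) (M m i : nat) (x y z : X) (g h : R -> R) :
  continuous_flow phi ->
  0 < T -> 0 < eta -> eta <= 1 -> delta <= eps / 4 ->
  (forall s w, `|s| < 5 * eta -> mdist w (phi s w) < eps / 4) ->
  continuous g -> continuous h -> g 0 = 0 -> h 0 = 0 ->
  (forall s, 0 <= s <= t -> mdist (phi s x) (phi (g s) y) <= delta) ->
  (forall s, 0 <= s <= t -> mdist (phi s x) (phi (h s) z) <= delta) ->
  (forall a b, 0 <= a -> a <= b -> b <= t -> b - a <= T ->
     `|(g b - b) - (g a - a)| < eta) ->
  (forall a b, 0 <= a -> a <= b -> b <= t -> b - a <= T ->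
     `|(h b - b) - (h a - a)| < eta) ->
  m%:R <= t -> M%:R * T <= m%:R -> m%:R < M.+1%:R * T ->
  (forall k, (k < M)%N ->
     drift_symbol eta (drift g T) k = drift_symbol eta (drift h T) k) ->
  (i + M <= m)%N -> mdist (phi i%:R y) (phi i%:R z) < eps.
Proof.
move=> fl T0 eta0 eta1 deps small gc hc g0 h0 gsh hsh gdr hdr mt Mm mM sym iM.
have [_ _ flowD] := fl.
have kT0 (k : nat) : 0 <= k%:R * T by rewrite mulr_ge0 // ltW.
have kTM (k : nat) : (k <= M)%N -> k%:R * T <= m%:R.
  by move=> kM; apply: le_trans Mm; rewrite ler_pM2r // ler_nat.
have step u : (forall a b, 0 <= a -> a <= b -> b <= t -> b - a <= T ->
     `|(u b - b) - (u a - a)| < eta) ->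
    forall k, (k < M)%N -> `|drift u T k.+1 - drift u T k| <= eta.
  move=> udr k kM; apply/ltW/udr => //.
  - by rewrite ler_pM2r // ler_nat.
  - exact: le_trans (kTM _ kM) mt.
  - by rewrite -mulrBl -natr1 addrAC subrr add0r mul1r.
have drift0 u : u 0 = 0 -> drift u T 0 = 0.
  by move=> u0; rewrite /drift mul0r u0 subrr.
have iMR : i%:R + M%:R <= m%:R :> R by rewrite -natrD ler_nat.
have [|s /andP[s0 sm] gs] := reparam_almost_reaches (v := i%:R) gc g0 (ltW eta0)
    (ler0n R m) (ler0n R i).
  have := drift_ge (drift0 g g0) (step g gdr) (leqnn M).
  have := gdr (M%:R * T) m%:R (kT0 M) Mm mt.
  move=> /(_ _)/ltW; rewrite ler_norml => /(_ _)/andP[|+ _].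
    by move: mM; rewrite -natr1 mulrDl mul1r; lra.
  have : M%:R * eta <= M%:R by rewrite ler_piMr.
  by rewrite /drift; lra.
(* The window that contains s. *)
pose k := Num.truncn (s / T).
have /andP[ks sk] : k%:R <= s / T < k.+1%:R.
  by apply: truncn_itv; rewrite divr_ge0 // ltW.
rewrite ler_pdivlMr // in ks; rewrite ltr_pdivrMr // in sk.
have kM : (k <= M)%N.
  rewrite -ltnS -(ltr_nat R) -(ltr_pM2r T0).
  exact: le_lt_trans ks (le_lt_trans sm mM).
have sk' : s - k%:R * T <= T.
  by move: sk; rewrite -natr1 mulrDl mul1r; lra.
have st : s <= t by exact: le_trans sm mt.
have dgh : `|drift g T k - drift h T k| < eta.
  apply: (same_drift_symbols_close eta0 _ (step g gdr) (step h hdr)) => //.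
  by rewrite !drift0.
have gk := gdr _ _ (kT0 k) ks st sk'; have hk := hdr _ _ (kT0 k) ks st sk'.
have hs : `|h s - i%:R| < 5 * eta.
  move: dgh gk hk gs; rewrite /drift !(ltr_norml, ler_norml).
  move=> /andP[? ?] /andP[? ?] /andP[? ?] /andP[? ?].
  by apply/andP; split; lra.
have gs' : `|g s - i%:R| < 5 * eta by lra.
have near_time u w : `|u - i%:R| < 5 * eta ->
    mdist (phi i%:R w) (phi u w) < eps / 4.
  by move=> uw; have := small _ (phi i%:R w) uw; rewrite -flowD subrKC.
have yy := near_time _ y gs'; have zz := near_time _ z hs.
have := gsh s; rewrite s0 st => /(_ isT).
have := hsh s; rewrite s0 st => /(_ isT).
have := metric_triangle (phi i%:R y) (phi (g s) y) (phi i%:R z).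
have := metric_triangle (phi (g s) y) (phi s x) (phi i%:R z).
have := metric_triangle (phi s x) (phi (h s) z) (phi i%:R z).
rewrite (metric_sym (phi (h s) z) (phi i%:R z)).
rewrite (metric_sym (phi (g s) y) (phi s x)); lra.
Qed.

Theorem lemma4p4 (R : realType) (X : metricType R) (phi : R -> X -> X)
    (L : nat) :
  compact [set: X] ->
  continuous_flow phi ->
  (forall x : X, ~ fixed_point phi x) ->
  (0 < L)%N ->
  forall eps : R, 0 < eps ->
  exists2 delta0 : R, 0 < delta0 &
  forall (x : X) (delta t : R),
    0 < delta < delta0 -> L%:R < t ->
    let f := phi 1 in
    let n := Num.truncn (t / L%:R) in
    (exists (l : nat) (c : 'I_l -> X),
       [/\ (l <= 3 ^ (n - 1))%N,
           forall i, Gamma_plus phi delta x t (c i) &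
           Gamma_plus phi delta x t `<=`
             \bigcup_i Bowen_ball f (n * L) (c i) eps]) /\
    (forall K : set X, compact K -> K x ->
       exists (l : nat) (c : 'I_l -> X),
         [/\ (l <= 3 ^ (n - 1))%N,
             forall i, K (c i) &
             K `&` Gamma_plus phi delta x t `<=`
               \bigcup_i Bowen_ball f (n * L) (c i) eps]).
Proof.
move=> cX fl nofix L0 eps eps0.
have eps40 : 0 < eps / 4 by rewrite divr_gt0.
have [T0 T00 noper] := no_small_period fl cX nofix.
have [u u0 small] := flow_small_time fl cX eps40.
(* eta <= 1 bounds the time lost over M windows by M; eta < T0 excludes it as a
   period. *)
pose eta := Num.min 1 (Num.min (T0 / 2) (u / 5)).
have eta0 : 0 < eta by rewrite !lt_min ltr01 !divr_gt0.
have [eta1 etaT etau] : [/\ eta <= 1, eta < T0 & 5 * eta <= u].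
  have : eta <= eta by []; rewrite {2}/eta !le_min => /and3P[? ? ?].
  by split; lra.
have [r [c cP]] := compact_small_classes cX eps0.
have [q rq] : exists q, (3 * r.+1 <= 3 ^ q)%N.
  by exists (3 * r.+1)%N; rewrite ltnW // ltn_expl.
pose T : R := (q.+1 * L)%:R.
have Tgt0 : 0 < T by rewrite ltr0n muln_gt0.
have noeta x : phi eta x <> x by apply: noper; rewrite eta0.
have [delta1 delta10 drP] := shadowing_drift_small fl T cX eta0 noeta.
exists (Num.min delta1 (eps / 4)) => [|x delta t]; first by rewrite lt_min delta10.
rewrite lt_min => /andP[delta0 /andP[dd1 deps]] Lt f n.
have L0R : 0 < L%:R :> R by rewrite ltr0n.
have t0 : 0 < t := lt_trans L0R Lt.
have n0 : (0 < n)%N.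
  by rewrite truncn_gt0 ler_pdivlMr // mul1r ltW.
have nt : (n * L)%:R <= t.
  have : n%:R <= t / L%:R by rewrite truncn_le divr_ge0 ?ltW.
  by rewrite ler_pdivlMr // natrM.
pose M := (n %/ q.+1)%N.
(* One reparametrization for each point; the identity serves as a default outside
   Gamma_plus. *)
have /choice[h hP] : forall y, exists h : R -> R, Gamma_plus phi delta x t y ->
    [/\ continuous h, h 0 = 0 & forall s, 0 <= s <= t ->
      mdist (phi s x) (phi (h s) y) <= delta].
  move=> y; have [[h [_ [hc _] h0] hs]|ny] := EM (Gamma_plus phi delta x t y).
    by exists h.
  by exists id.
(* The first component runs forward, k being the change of the drift over window
   k; the second one runs backward, k being the time nL - k. *)
pose code y : {ffun 'I_M -> 'I_3 * 'I_r.+1} :=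
  [ffun k : 'I_M => (drift_symbol eta (drift (h y) T) k,
                     c (phi (n * L - k)%:R y))].
have codeP y z : Gamma_plus phi delta x t y -> Gamma_plus phi delta x t z ->
    code y = code z -> Bowen_ball f (n * L) y eps z.
  move=> /hP[yc y0 ys] /hP[zc z0 zs] /ffunP yz i ile; rewrite !flow_iter //.
  have [iM|iM] := leqP (i + M) (n * L); last first.
    (* A time near the end: the cell of phi_i is part of the code. *)
    have kM : (n * L - i < M)%N by rewrite ltn_subLR.
    have := yz (Ordinal kM); rewrite !ffunE /= => -[_].
    by rewrite subKn // => /cP/ltW.
  have bound w (hw : R -> R) : continuous hw -> (forall s, 0 <= s <= t ->
      mdist (phi s x) (phi (hw s) w) <= delta) ->
      forall a b, 0 <= a -> a <= b -> b <= t -> b - a <= T ->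
      `|(hw b - b) - (hw a - a)| < eta.
    move=> hwc hws; apply: (drP x w hw t hwc) => s st.
    exact: le_trans (hws s st) (ltW dd1).
  apply/ltW/(same_symbols_close fl Tgt0 eta0 eta1 (ltW deps) _ yc zc y0 z0 ys zs
    (bound _ _ yc ys) (bound _ _ zc zs) nt _ _ _ iM).
  - by move=> s w su; apply: small; lra.
  - by rewrite -natrM ler_nat mulnA leq_mul2r leq_trunc_div orbT.
  - by rewrite -natrM ltr_nat mulnA ltn_mul2r L0 /= ltn_ceil.
  - by move=> k kM; have := yz (Ordinal kM); rewrite !ffunE /= => -[].
have cover (S : set X) : S `<=` Gamma_plus phi delta x t ->
    exists (l : nat) (d : 'I_l -> X),
      [/\ (l <= 3 ^ (n - 1))%N, forall i, S (d i) &
        S `<=` \bigcup_i Bowen_ball f (n * L) (d i) eps].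
  move=> SG.
  have [|l [d [lT dS Sd]]] := @pigeonhole_cover X _ code S
      (fun y => Bowen_ball f (n * L) y eps).
    by move=> y z /SG Gy /SG Gz; exact: codeP.
  exists l, d; split=> //; apply: leq_trans lT _.
  by rewrite card_ffun card_prod !card_ord code_count.
split=> [|K _ _]; first exact: cover.
have [|l [d [lT dS Sd]]] := cover (K `&` Gamma_plus phi delta x t).
  by move=> y [].
by exists l, d; split=> // i; have [] := dS i.
Qed.
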